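(* Let $C_{<i}(z)=\sum_{j=0}^{i-1}C_jz^j$ (the Catalan series truncated at degree $i$) and for $n\ge0$ let $K_n=(x-1)C_nq^nz^n+(q-1)C_{<n}(qz)$. Then $$F_{312}(x,q,z)=\cfrac{1}{1-zK_0-\cfrac{z}{1-zK_1-\cfrac{z}{1-zK_2-\cfrac{z}{1-zK_3-\cfrac{z}{\ddots}}}}}.$$
   Context: For permutations $\pi=\pi_1\cdots\pi_n\in\mathfrak{S}_n$ and $\sigma\in\mathfrak{S}_m$, $\pi$ contains $\sigma$ if there are indices $i_1<\dots<i_m$ such that $\pi_{i_1}\cdots\pi_{i_m}$ is in the same relative order as $\sigma$; otherwise $\pi$ avoids $\sigma$. $\mathfrak{S}_n(312)$ is the set of $312$-avoiding permutations in $\mathfrak{S}_n$. $\mathrm{fp}(\pi)=|\{i:\pi_i=i\}|$ and $\mathrm{exc}(\pi)=|\{i:\pi_i>i\}|$. $F_{312}(x,q,z)=\sum_{n\ge0}\sum_{\pi\in\mathfrak{S}_n(312)}x^{\mathrm{fp}(\pi)}q^{\mathrm{exc}(\pi)}z^n$. $C_n=\frac{1}{n+1}\binom{2n}{n}$. *)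

(* Defs.v *)
From HB Require Import structures.
From mathcomp Require Import all_boot all_order all_algebra all_fingroup.
From mathcomp Require Import boolp.
From mathcomp Require Import mpoly.

Set Implicit Arguments.
Unset Strict Implicit.
Unset Printing Implicit Defensive.

Import GRing.Theory.
Local Open Scope ring_scope.

(* Formal power series in one variable z: f n is the coefficient of z ^ n. *)
Record fps (R : Type) := Fps { fps_coef :> nat -> R }.

Notation "{ 'fps' R }" := (fps R) (at level 0, format "{ 'fps'  R }").

HB.instance Definition _ (R : Type) := gen_eqMixin {fps R}.
HB.instance Definition _ (R : Type) := gen_choiceMixin {fps R}.

Lemma fpsP (R : Type) (f g : {fps R}) : (forall n, f n = g n) -> f = g.
Proof. by case: f g => [f] [g] /= /funext ->. Qed.

Section FpsRing.
Variable R : comNzRingType.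
Implicit Types (f g h : {fps R}) (a : R).

Definition fpsC a : {fps R} := Fps (fun n => a *+ (n == 0%N)).
Definition fpsZ : {fps R} := Fps (fun n => (n == 1%N)%:R).

Definition fps_add f g : {fps R} := Fps (fun n => f n + g n).
Definition fps_opp f : {fps R} := Fps (fun n => - f n).
Definition fps_mul f g : {fps R} :=
  Fps (fun n => \sum_(i < n.+1) f i * g (n - i)%N).

Fact fps_addA : associative fps_add.
Proof. by move=> f g h; apply: fpsP => n /=; rewrite addrA. Qed.
Fact fps_addC : commutative fps_add.
Proof. by move=> f g; apply: fpsP => n /=; rewrite addrC. Qed.
Fact fps_add0 : left_id (fpsC 0) fps_add.
Proof. by move=> f; apply: fpsP => n /=; rewrite mul0rn add0r. Qed.
Fact fps_addN : left_inverse (fpsC 0) fps_opp fps_add.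
Proof. by move=> f; apply: fpsP => n /=; rewrite mul0rn addNr. Qed.

HB.instance Definition _ :=
  GRing.isZmodule.Build {fps R} fps_addA fps_addC fps_add0 fps_addN.

Let trunc N f : {poly R} := \poly_(i < N.+1) f i.

Let coef_trunc N f i : (i <= N)%N -> (trunc N f)`_i = f i.
Proof. by move=> iN; rewrite coef_poly ltnS iN. Qed.

Let coef_mul_trunc N f g i : (i <= N)%N ->
  fps_mul f g i = (trunc N f * trunc N g)`_i.
Proof.
move=> iN; rewrite coefM; apply: eq_bigr => -[j /= ji] _.
rewrite !coef_trunc //; first exact: leq_trans (leq_subr _ _) iN.
exact: leq_trans iN.
Qed.

Fact fps_mulC : commutative fps_mul.
Proof.
by move=> f g; apply: fpsP => n; rewrite !(coef_mul_trunc _ _ (leqnn n)) mulrC.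
Qed.

Fact fps_mulA : associative fps_mul.
Proof.
move=> f g h; apply: fpsP => n.
transitivity ((trunc n f * (trunc n g * trunc n h))`_n).
  rewrite coefM; apply: eq_bigr => i _.
  by rewrite (coef_mul_trunc _ _ (leq_subr i n)) coef_trunc // -ltnS.
rewrite mulrA coefM; apply: eq_bigr => i _.
by rewrite (@coef_mul_trunc n) -1?ltnS // [(trunc n h)`_ _]coef_trunc ?leq_subr.
Qed.

Fact fps_mul1 : left_id (fpsC 1) fps_mul.
Proof.
move=> f; apply: fpsP => n /=.
by rewrite big_ord_recl /= subn0 mul1r big1 ?addr0 // => i _; rewrite mul0r.
Qed.

Fact fps_mulD : left_distributive fps_mul fps_add.
Proof.
move=> f g h; apply: fpsP => n /=; rewrite -big_split /=.
by apply: eq_bigr => i _; rewrite mulrDl.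
Qed.

Fact fps_1neq0 : fpsC 1 != 0.
Proof.
apply/eqP => /(congr1 (fun f : {fps R} => f 0%N)) /eqP.
by rewrite /= oner_eq0.
Qed.

HB.instance Definition _ := GRing.Zmodule_isComNzRing.Build {fps R}
  fps_mulA fps_mulC fps_mul1 fps_mulD fps_1neq0.

Lemma fpsDE f g n : (f + g) n = f n + g n. Proof. by []. Qed.
Lemma fpsNE f n : (- f) n = - f n. Proof. by []. Qed.
Lemma fpsME f g n : (f * g) n = \sum_(i < n.+1) f i * g (n - i)%N.
Proof. by []. Qed.
Lemma fps1E n : (1 : {fps R}) n = (n == 0%N)%:R. Proof. by []. Qed.

End FpsRing.

Notation "a %:FS" := (fpsC a) (at level 1, format "a %:FS") : ring_scope.
Notation "''z'" := (fpsZ _) : ring_scope.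

Section FpsInv.
Variable R : comUnitRingType.
Implicit Types f g : {fps R}.

(* The first n.+1 coefficients of 1 / f. *)
Fixpoint fps_inv_seq f n : seq R :=
  if n is m.+1 then
    let s := fps_inv_seq f m in
    rcons s (- (f 0%N)^-1 * \sum_(k < m.+1) f k.+1 * s`_(m - k))
  else [:: (f 0%N)^-1].

Definition fps_unit : {pred {fps R}} := fun f => f 0%N \is a GRing.unit.

(* As usual for rings with units, inversion is the identity on non-units. *)
Definition fps_inv f : {fps R} :=
  if f \in fps_unit then Fps (fun n => (fps_inv_seq f n)`_n) else f.

Let size_inv_seq f n : size (fps_inv_seq f n) = n.+1.
Proof. by elim: n => //= n IHn; rewrite size_rcons IHn. Qed.

Let nth_inv_seq f n i :
  (i <= n)%N -> (fps_inv_seq f n)`_i = (fps_inv_seq f i)`_i.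
Proof.
elim: n => [|n IHn]; first by rewrite leqn0 => /eqP ->.
rewrite leq_eqVlt => /orP[/eqP -> //|]; rewrite ltnS => le_in.
by rewrite /= nth_rcons size_inv_seq ltnS le_in IHn.
Qed.

Fact fps_mulVf : {in fps_unit, left_inverse 1 fps_inv *%R}.
Proof.
move=> f Uf; rewrite mulrC; apply: fpsP => -[|n]; rewrite fpsME /fps_inv Uf.
  by rewrite big_ord1 /= mulrV.
rewrite fps1E big_ord_recl subn0 /= nth_rcons size_inv_seq ltnn eqxx.
rewrite mulrA mulrN mulrV // mulN1r; apply/eqP.
rewrite addrC subr_eq0; apply/eqP/eq_bigr => i _.
by rewrite /bump leq0n add1n subSS [in RHS]nth_inv_seq ?leq_subr.
Qed.

Fact fps_unitPl f g : g * f = 1 -> f \in fps_unit.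
Proof.
move/(congr1 (fun h : {fps R} => h 0%N)); rewrite fpsME big_ord1 fps1E /= => gf1.
by apply/unitrPr; exists (g 0%N); rewrite mulrC.
Qed.

Fact fps_invr_out : {in [predC fps_unit], fps_inv =1 id}.
Proof. by move=> f nUf; rewrite /fps_inv ifN. Qed.

HB.instance Definition _ := GRing.ComNzRing_hasMulInverse.Build {fps R}
  fps_mulVf fps_unitPl fps_invr_out.

Lemma fps_unitE f : (f \is a GRing.unit) = (f 0%N \is a GRing.unit).
Proof. by []. Qed.

End FpsInv.

(* Convergence for the z-adic topology: every coefficient is eventually equal
   to that of the limit. *)
Definition fps_cvg (R : Type) (u : nat -> {fps R}) (f : {fps R}) : Prop :=
  forall n, exists M, forall m, (M <= m)%N -> u m n = f n.

Section ContinuedFraction.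
Variable R : comUnitRingType.
Implicit Types K : nat -> {fps R}.

(* convergent K i m is the finite continued fraction
   1 / (1 - z K_i - z / (1 - z K_(i+1) - z / ... z / (1 - z K_(i+m)))) *)
Fixpoint convergent K i m : {fps R} :=
  if m is p.+1 then (1 - 'z * K i - 'z * convergent K i.+1 p)^-1
  else (1 - 'z * K i)^-1.

(* The value of the infinite continued fraction, as the limit of its
   convergents. *)
Definition continued_fraction_eq K (f : {fps R}) : Prop :=
  fps_cvg (convergent K 0) f.

(* No junk inverse ever occurs in convergent. *)
Lemma denominator_unit K i (g : {fps R}) :
  (1 - 'z * K i \is a GRing.unit) /\ (1 - 'z * K i - 'z * g \is a GRing.unit).
Proof.
by rewrite !fps_unitE !(fpsDE, fpsNE, fpsME, fps1E, big_ord1) /= !mul0r !subr0 unitr1.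
Qed.

End ContinuedFraction.

Definition contains m n (pi : 'S_n) (sigma : 'S_m) : bool :=
  [exists i : {ffun 'I_m -> 'I_n},
    [forall a : 'I_m, forall b : 'I_m,
      (a < b)%N ==> (i a < i b)%N] &&
    [forall a : 'I_m, forall b : 'I_m,
      (pi (i a) < pi (i b))%N == (sigma a < sigma b)%N]].

Definition avoids m n (pi : 'S_n) (sigma : 'S_m) : bool := ~~ contains pi sigma.

(* The cyclic predecessor on 'I_3, whose one-line notation is 312 when
   positions and values are counted from 1. *)
Definition p312 : 'S_3 := perm (@ord_pred_inj 3).

Lemma p312E : [seq (p312 i).+1 | i <- enum 'I_3] = [:: 3; 1; 2]%N.
Proof.
by rewrite (eq_map (fun i => congr1 (fun j : 'I_3 => j.+1) (permE _ i)))
  (map_comp (fun k => ((k + 3).-1 %% 3).+1) val) val_enum_ord.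
Qed.

Definition fp n (pi : 'S_n) : nat := #|[set i : 'I_n | pi i == i]|.
Definition exc n (pi : 'S_n) : nat := #|[set i : 'I_n | (i < pi i)%N]|.

Definition catalan n : nat := 'C(n.*2, n) %/ n.+1.

Lemma catalanE n : (n.+1 * catalan n)%N = 'C(n.*2, n).
Proof.
rewrite mulnC divnK // -(dvdn_addr _ (dvdn_mulr 'C(n.*2, n.+1) (dvdnn n.+1))).
by rewrite mul_bin_left -addnn addnK -mulSnr dvdn_mulr.
Qed.

(* The Catalan series truncated at degree i, evaluated at t. *)
Definition catalan_lt (S : pzRingType) i (t : S) : S :=
  \sum_(j < i) (catalan j)%:R * t ^+ j.

Section Series.
Variables (R : comUnitRingType) (x q : R).

Definition F312 : {fps R} :=
  Fps (fun n => \sum_(pi : 'S_n | avoids pi p312) x ^+ fp pi * q ^+ exc pi).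

Definition Kseries n : {fps R} :=
  (x%:FS - 1) * (catalan n)%:R * q%:FS ^+ n * 'z ^+ n
  + (q%:FS - 1) * catalan_lt n (q%:FS * 'z).

End Series.

(* Main.v *)
(** Let [F_s] be the generating function of the 312-avoiding permutations in
    which position [i] is compared with the shifted value [pi i + s], so that
    [F_0 = F312].  Cutting a nonempty 312-avoider at its minimum gives
    [pi = (A + 1) 0 (B + |A| + 1)] with [A] and [B] arbitrary 312-avoiders (every
    letter before the minimum is smaller than every letter after it).  In [F_s]
    the block [A] contributes to [F_(s+1)], the block [B] to [F_s], and the
    minimum, at position [|A|] with shifted value [s], weighs [q], [x] or [1]
    according to whether [|A|] is smaller than, equal to or larger than [s].
    When [|A| <= s] all letters of [A] are excedances in [F_(s+1)], hence the
    coefficient of [z ^ |A|] there is a Catalan number times [q ^ |A|], and the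
    corrections with respect to the weight [1] add up to [K_s]:
    [F_s = 1 + z (K_s + F_(s+1)) F_s].  Iterating this is the continued fraction. *)

Require Import Defs.
From mathcomp Require Import all_boot all_order all_algebra all_fingroup.
From mathcomp Require Import mpoly zify ring.
Set Implicit Arguments.
Unset Strict Implicit.
Unset Printing Implicit Defensive.
Import GRing.Theory.
Local Open Scope nat_scope.

(** * Recurrences of the Catalan numbers *)

Lemma catalanS n : n.+2 * catalan n.+1 = n.*2.+1.*2 * catalan n.
Proof.
apply/eqP; rewrite -(eqn_pmul2l (ltn0Sn n)); apply/eqP.
rewrite catalanE [RHS]mulnCA catalanE doubleS.
have := mul_bin_diag n.*2.+2 n; have /= := mul_bin_down n.*2.+1 n.
have -> : n.*2.+1 - n = n.+1 by lia.
by move=> E <-; rewrite -[n.*2.+2]doubleS -!doubleMl E.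
Qed.

(* By symmetry the convolution weighted by [i] is [n / 2] times the convolution;
   combined with [catalanS] this gives the convolution the same first-order
   recurrence as the Catalan numbers. *)
Lemma catalan_conv n : catalan n.+1 = \sum_(i < n.+1) catalan i * catalan (n - i).
Proof.
elim: n => [|n IHn]; first by rewrite big_ord1.
set S := fun m => \sum_(i < m.+1) catalan i * catalan (m - i).
have wsum m : (\sum_(i < m.+1) i * (catalan i * catalan (m - i))).*2 = m * S m.
  rewrite -addnn {2}(reindex_inj rev_ord_inj) -big_split big_distrr /=.
  apply: eq_bigr => i _; rewrite subSS subKn; last by rewrite -ltnS.
  rewrite [catalan (m - i) * _]mulnC -mulnDl subnKC //.
  by rewrite -ltnS.
have := wsum n; have := wsum n.+1; rewrite -/(S n) in IHn; rewrite -/(S n.+1).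
(* Adding the two sums gives factors [i + 1]. The term at 0 is [catalan n.+1], and [catalanS] turns
   each later one into [(4 * i + 2) * catalan i * catalan (n - i)]. *)
have SS : S n.+1 + \sum_(i < n.+2) i * (catalan i * catalan (n.+1 - i)) =
   catalan n.+1 + (\sum_(i < n.+1) i * (catalan i * catalan (n - i))) * 4 + 2 * S n.
  rewrite /S -big_split [LHS]big_ord_recl /= mul0n addn0 mul1n subn0 -addnA; congr (_ + _).
  rewrite big_distrl big_distrr -big_split; apply: eq_bigr => i _ /=.
  rewrite /bump leq0n add1n subSS.
  have := catalanS i; nia.
have := catalanS n.+1; rewrite -IHn in SS *; nia.
Qed.

(** * Words avoiding 312 *)

(** The head [a] is tested as the 3 of an occurrence, with [b] before [c] as the 1 and the 2; the
    recursion tests the other candidates for the 3. *)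
Fixpoint av312 (s : seq nat) : bool :=
  if s is a :: t then pairwise (fun b c => ~~ (b < c < a)) t && av312 t
  else true.

Definition avoiders n := [seq s <- permutations (iota 0 n) | av312 s].

Definition join312 A B := map S A ++ 0 :: map (addn (size A).+1) B.

Lemma mem_avoiders n s : (s \in avoiders n) = av312 s && perm_eq s (iota 0 n).
Proof. by rewrite mem_filter mem_permutations. Qed.

Lemma uniq_avoiders n : uniq (avoiders n).
Proof. exact/filter_uniq/permutations_uniq. Qed.

(** * Cutting a word at its minimum *)

Lemma av312_map (f : nat -> nat) s :
  {mono f : a b / a < b} -> av312 (map f s) = av312 s.
Proof.
move=> mf; elim: s => //= a s ->; rewrite pairwise_map; congr (_ && _).
by apply: eq_pairwise => b c /=; rewrite !mf.
Qed.

(** The 2 of an occurrence lies below its 3 and above its 1. If the 3 is in [A], the 2 is neither 0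
    nor in [B], so the occurrence stays inside [A]; and 0 cannot be a 3. *)
Lemma av312_cat0 A B :
  allrel ltn A B -> av312 (A ++ 0 :: B) = av312 A && av312 B.
Proof.
elim: A => /= [_|a A IHA].
  rewrite (_ : pairwise _ B) //; apply/(pairwiseP 0) => i j _ _ _.
  by rewrite ltn0 andbF.
rewrite allrel_consl => /andP[/allP aB AB]; rewrite IHA // !andbA; congr (_ && _ && _).
rewrite pairwise_cat /=.
set r := fun b c => _.
have rB b c : c \in B -> r b c by move=> /aB /=; rewrite /r; lia.
have -> : allrel r A (0 :: B).
  apply/allrelP => b c _; rewrite inE => /predU1P[->|/rB//].
  by rewrite /r ltn0.
have -> : all (r 0) B by apply/allP => c /rB.
rewrite (_ : pairwise r B) ?andbT //.
by apply/(pairwiseP 0) => i j _ jB _; apply/rB/mem_nth.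
Qed.

(** Letters [a] of [A] and [b] of [B] with [b < a] would form the occurrence [a 0 b]; uniqueness
    excludes [b = a] and [b = 0]. *)
Lemma av312_allrel A B :
  uniq (A ++ 0 :: B) -> av312 (A ++ 0 :: B) -> allrel ltn A B.
Proof.
elim: A => //= a A IHA /andP[aAB uAB] /andP[pAB avAB].
rewrite allrel_consl IHA // andbT; apply/allP => b bB.
move: pAB; rewrite pairwise_cat /= => /and4P[_ _ /allP/(_ b bB)].
move: aAB; rewrite mem_cat !inE !negb_or => /and3P[_ a0 aB] ba _.
have ab : a != b by apply: contraNneq aB => ->.
have b0 : b != 0.
  move: uAB; rewrite cat_uniq /= => /and4P[_ _ B0 _].
  by apply: contraNneq B0 => <-.
rewrite /=; lia.
Qed.

Lemma perm_shift n k s :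
  perm_eq s (iota k n) -> exists2 t, s = map (addn k) t & perm_eq t (iota 0 n).
Proof.
move=> sP; exists (map (subn^~ k) s).
  rewrite -map_comp -[LHS]map_id; apply/eq_in_map => a.
  by rewrite (perm_mem sP) mem_iota /= => /andP[ka _]; rewrite subnKC.
have -> : iota 0 n = map (subn^~ k) (iota k n).
  rewrite -{2}[k]addn0 iotaDl -map_comp -[LHS]map_id.
  by apply: eq_map => a /=; rewrite addKn.
exact: perm_map.
Qed.

Lemma perm_split A B n : allrel ltn A B -> perm_eq (A ++ 0 :: B) (iota 0 n.+1) ->
  perm_eq A (iota 1 (size A)) /\ perm_eq B (iota (size A).+1 (n - size A)).
Proof.
move=> AB pAB; have nE : size A + size B = n.
  by move/perm_size: pAB; rewrite size_cat size_iota /= addnS => -[].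
(* Since [A] lies below [B], sorting the blocks separately already sorts the whole word; cutting the
   interval at [size A] then identifies both blocks. *)
have E : 0 :: sort leq A ++ sort leq B = iota 0 n.+1.
  apply: (sorted_eq leq_trans anti_leq); last 1 first.
  - rewrite perm_sym; apply: perm_trans (_ : perm_eq (A ++ 0 :: B) _).
      by rewrite perm_sym.
    rewrite -[0 :: B]cat1s perm_catCA /= perm_cons.
    by apply: perm_cat; rewrite perm_sym perm_sort.
  - rewrite /= path_min_sorted; last exact/allP.
    rewrite (sorted_pairwise leq_trans) pairwise_cat.
    rewrite -!(sorted_pairwise leq_trans) !sort_sorted ?andbT; try exact: leq_total.
    apply/allrelP => a b; rewrite !mem_sort => aA bB.
    by apply: ltnW; exact: (allrelP AB).
  - exact: iota_sorted.
move: E; rewrite -{1}nE /= -nE iotaD add1n => -[/eqP].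
rewrite eqseq_cat ?size_sort ?size_iota // addKn => /andP[/eqP <- /eqP <-].
by split; rewrite perm_sym perm_sort.
Qed.

Lemma join312_inj A B A' B' :
  join312 A B = join312 A' B' -> A = A' /\ B = B'.
Proof.
(* The letters of [map S C] are positive, so the first 0 marks the length of the first block. *)
have iE C D : index 0 (join312 C D) = size C.
  rewrite index_cat ifN /= ?addn0 ?size_map //.
  by apply/mapP => -[].
move=> E; have sE : size A = size A' by rewrite -(iE A B) E iE.
move: E => /eqP; rewrite /join312 eqseq_cat ?size_map //.
case/andP => /eqP/(inj_map succn_inj) -> /eqP[].
by move/(inj_map (@addnI _)).
Qed.

Lemma join312_avoiders k m A B : A \in avoiders k -> B \in avoiders m ->
  join312 A B \in avoiders (k + m).+1.
Proof.
rewrite !mem_avoiders => /andP[avA pA] /andP[avB pB].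
have sA : size A = k by rewrite (perm_size pA) size_iota.
apply/andP; split.
  rewrite av312_cat0; last first.
    apply/allrelP => _ _ /mapP[a aA ->] /mapP[b _ ->].
    move: aA; rewrite (perm_mem pA) mem_iota sA /=; lia.
  by rewrite !av312_map ?avA // => a b; rewrite ?ltn_add2l ?ltnS.
rewrite /join312 -[0 :: _]cat1s perm_catCA /= perm_cons iotaD sA add1n.
apply: perm_cat.
  by rewrite (iotaDl 1) (eq_map add1n); apply: perm_map.
rewrite -[k.+1]addn0 iotaDl; under [X in perm_eq X]eq_map do rewrite addn0.
exact: perm_map.
Qed.

Lemma avoiders_join312 n s : s \in avoiders n.+1 ->
  exists k A B, [/\ k <= n, A \in avoiders k, B \in avoiders (n - k)
                  & s = join312 A B].
Proof.
rewrite mem_avoiders => /andP[].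
have [/splitPr[A B]|s0] := boolP (0 \in s); last first.
  by move=> _ /perm_mem/(_ 0); rewrite (negPf s0) mem_iota.
move=> av pAB; have uAB : uniq (A ++ 0 :: B) by rewrite (perm_uniq pAB) iota_uniq.
have AB := av312_allrel uAB av.
have [/perm_shift[A' AE pA'] /perm_shift[B' BE pB']] := perm_split AB pAB.
move: av; rewrite av312_cat0 // => /andP[].
rewrite {1}AE {1}BE !av312_map => [avA avB|a b|a b]; rewrite ?ltn_add2l //.
exists (size A), A', B'; split; rewrite ?mem_avoiders ?avA ?avB //.
  by move/perm_size: pAB; rewrite size_cat size_iota /=; lia.
rewrite /join312 {1}AE {1}BE (eq_map add1n); congr (_ ++ 0 :: map (addn _.+1) _).
by rewrite AE size_map.
Qed.

Lemma avoiders_rec n : perm_eq (avoiders n.+1)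
  [seq join312 p.1 p.2 | k <- iota 0 n.+1,
     p <- [seq (A, B) | A <- avoiders k, B <- avoiders (n - k)]].
Proof.
have szA k A : A \in avoiders k -> size A = k.
  by rewrite mem_avoiders => /andP[_ /perm_size ->]; rewrite size_iota.
apply: uniq_perm; first exact: uniq_avoiders.
  apply: allpairs_uniq_dep => [|k _|]; first exact: iota_uniq.
    by apply: allpairs_uniq; rewrite ?uniq_avoiders // => -[? ?] [? ?].
  move=> u v /allpairsPdep[k [p [_ /allpairsP[[A B] [Ak _ ->]] ->]]] {u p}.
  case/allpairsPdep=> [k' [p' [_ /allpairsP[[A' B'] [Ak' _ ->]] ->]]] {v p'} /=.
  case/join312_inj => eA eB; rewrite -{}eA -{}eB in Ak' *.
  by rewrite -(szA _ _ Ak) -(szA _ _ Ak').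
move=> s; apply/idP/allpairsPdep.
  case/avoiders_join312 => k [A [B [kn Ak Bk ->]]]; exists k, (A, B).
  by split; rewrite ?mem_iota ?add0n ?ltnS //; apply: allpairs_f.
case=> k [_ [kn /allpairsP[[A B] [Ak Bk ->]] ->]].
rewrite mem_iota add0n ltnS /= in kn.
by rewrite -(subnKC kn); apply: join312_avoiders.
Qed.

Lemma big_avoiders (R : nmodType) n (f : seq nat -> R) :
  (\sum_(s <- avoiders n.+1) f s =
   \sum_(k < n.+1) \sum_(A <- avoiders k) \sum_(B <- avoiders (n - k))
     f (join312 A B))%R.
Proof.
rewrite (perm_big _ (avoiders_rec n)) big_allpairs_dep -[iota 0 n.+1]/(index_iota 0 n.+1).
by rewrite big_mkord; apply: eq_bigr => k _; rewrite big_allpairs_dep.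
Qed.

Lemma size_avoiders n : size (avoiders n) = catalan n.
Proof.
elim/ltn_ind: n => -[//|n] IHn.
rewrite catalan_conv -sum1_size big_avoiders; apply: eq_bigr => k _.
rewrite -!IHn ?ltnS ?leq_subr -?[k <= n]ltnS //.
by under eq_bigr do rewrite sum1_size; rewrite big_const_seq count_predT iter_addn_0 mulnC.
Qed.

(** * From permutations to words *)

Lemma av312P s : reflect
  (forall i j k, i < j -> j < k -> k < size s ->
     ~~ (nth 0 s j < nth 0 s k < nth 0 s i))
  (av312 s).
Proof.
elim: s => [|a s IHs] /=; first by left.
apply: (iffP andP) => [[/(pairwiseP 0) pas /IHs avs] [|i] [|j] [|k] //= ij jk ks|avs].
- by apply: pas; rewrite // inE; lia.
- exact: avs.
split; last by apply/IHs => i j k ij jk ks; exact: (avs i.+1 j.+1 k.+1).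
by apply/(pairwiseP 0) => j k _ ks jk; exact: (avs 0 j.+1 k.+1).
Qed.

Definition word n (pi : 'S_n) : seq nat := [seq val (pi i) | i <- enum 'I_n].

Lemma size_word n (pi : 'S_n) : size (word pi) = n.
Proof. by rewrite size_map size_enum_ord. Qed.

Lemma nth_word n (pi : 'S_n) (i : 'I_n) : nth 0 (word pi) i = pi i.
Proof. by rewrite (nth_map i) ?size_enum_ord ?nth_ord_enum. Qed.

Lemma av312_word n (pi : 'S_n) : av312 (word pi) = avoids pi p312.
Proof.
apply/av312P/idP => [av|/existsPn av i j k ij jk]; last first.
  rewrite size_word => kn; have jn := ltn_trans jk kn; have iN := ltn_trans ij jn.
  apply/negP; rewrite (nth_word pi (Ordinal kn)) (nth_word pi (Ordinal jn)).
  rewrite (nth_word pi (Ordinal iN)) => /andP[pjk pki].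
  (* The default value of [nth] supplies the third position, [k]. *)
  pose f := [ffun a : 'I_3 => nth (Ordinal kn) [:: Ordinal iN; Ordinal jn] a].
  have := av f; rewrite negb_and => /orP[] /negP[];
    apply/forallP => a; apply/forallP => b; rewrite !ffunE ?permE.
    by case: a b => [[|[|[|//]]] ?] [[|[|[|//]]] ?] //=; lia.
  by case: a b => [[|[|[|//]]] ?] [[|[|[|//]]] ?] //=; lia.
apply/existsPn => f; apply/negP => /andP[/forallP mf /forallP of_].
pose o (k : nat) : 'I_3 := inord k.
have lt3 a b : a < b < 3 -> f (o a) < f (o b).
  case/andP=> ab b3; have /forallP/(_ (o b))/implyP := mf (o a); apply.
  by rewrite !inordK //; lia.
have pE a b : (pi (f (o a)) < pi (f (o b))) = (p312 (o a) < p312 (o b)).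
  by have /forallP/(_ (o b))/eqP := of_ (o a).
have := av _ _ _ (lt3 0 1 isT) (lt3 1 2 isT); rewrite size_word => /(_ (ltn_ord _)).
by rewrite !nth_word !pE !permE /= !inordK.
Qed.

Lemma perm_words n :
  perm_eq [seq word pi | pi <- index_enum 'S_n] (permutations (iota 0 n)).
Proof.
have inj : injective (@word n).
  by move=> p p' E; apply/permP => i; apply: val_inj; rewrite /= -!nth_word E.
have u : uniq [seq word pi | pi <- index_enum 'S_n].
  by rewrite map_inj_uniq ?index_enum_uniq.
have sub : {subset [seq word pi | pi <- index_enum 'S_n] <= permutations (iota 0 n)}.
  move=> _ /mapP[p _ ->]; rewrite mem_permutations uniq_perm ?iota_uniq //.
    by rewrite map_inj_uniq ?enum_uniq //; apply: inj_comp perm_inj; exact: val_inj.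
  move=> a; rewrite mem_iota add0n /=; apply/mapP/idP => [[i _ ->]|an]; first exact: ltn_ord.
  by exists (p^-1%g (Ordinal an)); rewrite ?mem_enum // permKV.
apply: uniq_perm; rewrite ?permutations_uniq //.
(* A duplicate-free list of [n!] words inside another list of [n!] words has the same members. *)
have [|//] := uniq_min_size u sub.
by rewrite size_permutations ?iota_uniq // size_iota size_map -sum1_size
  -card_Sn -sum1_card (eq_bigl xpredT).
Qed.

Lemma big_words (R : nmodType) n (f : seq nat -> R) :
  (\sum_(pi : 'S_n | avoids pi p312) f (word pi) = \sum_(s <- avoiders n) f s)%R.
Proof.
rewrite big_filter -(perm_big _ (perm_words n)) big_map.
by apply: eq_bigl => pi; rewrite av312_word.
Qed.

(** * Generating functions *)

Local Open Scope ring_scope.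

(** * Weighted words and shifted generating functions *)

Section Weights.
Variables (R : comUnitRingType) (x q : R).

Definition wt (v i : nat) : R :=
  if (i < v)%N then q else if v == i then x else 1.

Fixpoint wts (i : nat) (s : seq nat) : R :=
  if s is a :: t then wt a i * wts i.+1 t else 1.

Lemma wts_cat i s t : wts i (s ++ t) = wts i s * wts (i + size s) t.
Proof.
elim: s i => [|a s IHs] i /=; first by rewrite addn0 mul1r.
by rewrite IHs mulrA addSnnS.
Qed.

Lemma wts_shift c i s : wts (c + i) (map (addn c) s) = wts i s.
Proof.
by elim: s i => //= a s IHs i; rewrite -addnS IHs /wt ltn_add2l eqn_add2l.
Qed.

Lemma wts_exc i s : all (leq (i + size s)) s -> wts i s = q ^+ size s.
Proof.
elim: s i => //= a s IHs i /andP[ia sP].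
by rewrite IHs ?exprS ?addSnnS // /wt (leq_trans _ ia) // addnS ltnS leq_addr.
Qed.

Lemma wts_map_addn s i w :
  wts i (map (addn s) w) = \prod_(j < size w) wt (s + nth 0%N w j) (i + j).
Proof.
elim: w i => [|a w IHw] i /=; first by rewrite big_ord0.
rewrite big_ord_recl addn0 IHw; congr (_ * _).
by apply: eq_bigr => j _; rewrite /= /bump leq0n add1n addnS.
Qed.

Lemma wts_word n (pi : 'S_n) : wts 0 (word pi) = x ^+ fp pi * q ^+ exc pi.
Proof.
rewrite -(map_id (word pi)) (wts_map_addn 0) size_word.
(* No position is both fixed and an excedance, so each weight splits into two independent
   factors. *)
transitivity (\prod_(i < n) ((if pi i == i then x else 1) *
                             (if (i < pi i)%N then q else 1))).
  apply: eq_bigr => i _; rewrite nth_word /wt add0n -val_eqE /=.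
  by case: ltngtP; rewrite ?mul1r ?mulr1.
rewrite big_split /= -!big_mkcond /= !prodr_const.
by congr (_ ^+ _ * _ ^+ _); apply: eq_card => i; rewrite !inE.
Qed.

(** This is the coefficient of [z ^ n] in the series [F_s]. *)
Definition Fshift s n : R := \sum_(w <- avoiders n) wts 0 (map (addn s) w).

Lemma Fshift0 n : Fshift 0 n = F312 x q n.
Proof.
rewrite /Fshift -big_words; apply: eq_bigr => pi _.
by rewrite -wts_word map_id.
Qed.

(** Shifted values are at least [s], while positions are below [n <= s]: every letter is an
    excedance. *)
Lemma Fshift_exc s n : (n <= s)%N -> Fshift s n = (catalan n)%:R * q ^+ n.
Proof.
move=> ns; rewrite /Fshift big_seq (eq_bigr (fun=> q ^+ n)) => [|w].
  rewrite -big_seq big_const_seq count_predT size_avoiders iter_addr_0.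
  by rewrite mulr_natl.
rewrite mem_avoiders => /andP[_ /perm_size]; rewrite size_iota => szw.
rewrite wts_exc size_map szw //; apply/allP => _ /mapP[a _ ->].
by rewrite add0n (leq_trans ns) ?leq_addr.
Qed.

(** Letters of [A] keep their positions but are raised by one more, hence [s.+1]. Letters of [B]
    move by [(size A).+1] in both position and value, which leaves their weights unchanged. *)
Lemma wts_join312 s A B : wts 0 (map (addn s) (join312 A B)) =
  wts 0 (map (addn s.+1) A) * wt s (size A) * wts 0 (map (addn s) B).
Proof.
rewrite map_cat wts_cat add0n !size_map -map_comp /= addn0 mulrA.
congr (_ * _ * _); first by congr wts; apply: eq_map => a /=; rewrite addSnnS.
rewrite -[in RHS](wts_shift (size A).+1) addn0 -!map_comp; congr wts.
by apply: eq_map => a /=; rewrite addnCA.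
Qed.

Lemma FshiftS s n : Fshift s n.+1 =
  \sum_(k < n.+1) wt s k * Fshift s.+1 k * Fshift s (n - k).
Proof.
rewrite /Fshift big_avoiders; apply: eq_bigr => k _.
rewrite -mulrA big_distrl big_distrr /= big_seq [RHS]big_seq; apply: eq_bigr => A.
rewrite mem_avoiders => /andP[_ /perm_size]; rewrite size_iota => sA.
rewrite mulrA big_distrr; apply: eq_bigr => B _.
by rewrite wts_join312 sA [wts _ _ * wt _ _]mulrC.
Qed.

End Weights.

(** * Coefficients of formal power series *)

Section PowerSeries.
Variable R : comNzRingType.
Implicit Types f g : {fps R}.

Lemma coef_fpsCM (a : R) f n : (a%:FS * f) n = a * f n.
Proof.
rewrite fpsME big_ord_recl subn0 big1 ?addr0 ?mulr1n // => i _.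
by rewrite /= mulr0n mul0r.
Qed.

Lemma coef_fpsZM f n : ('z * f) n = if n is m.+1 then f m else 0.
Proof.
case: n => [|n]; first by rewrite fpsME big_ord1 mul0r.
rewrite fpsME !big_ord_recl big1 => [|i _]; last by rewrite mul0r.
by rewrite /= mul0r add0r mul1r subSS subn0 addr0.
Qed.

Lemma coef_fpsZnM k f n :
  ('z ^+ k * f) n = if (n < k)%N then 0 else f (n - k)%N.
Proof.
elim: k n => [|k IHk] n; first by rewrite mul1r subn0.
by rewrite exprS -mulrA coef_fpsZM; case: n => // n; rewrite IHk subSS.
Qed.

Lemma coef_fpsZn k n : ('z ^+ k : {fps R}) n = (n == k)%:R.
Proof.
rewrite -[_ ^+ k]mulr1 coef_fpsZnM fps1E.
by case: ltngtP => [||->]; rewrite ?subnn // subn_eq0 => /ltn_geF ->.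
Qed.

Lemma fpsC_exp (a : R) n : (a%:FS ^+ n : {fps R}) = (a ^+ n)%:FS.
Proof.
elim: n => // n IHn; apply: fpsP => m.
by rewrite exprS IHn coef_fpsCM /= exprS mulrnAr.
Qed.

Lemma fps_natr n : (n%:R : {fps R}) = (n%:R)%:FS.
Proof.
elim: n => [|n IHn]; first by rewrite mulr0n.
by apply: fpsP => m; rewrite mulrS IHn fpsDE /= -mulrnDl mulrS.
Qed.

Lemma fpsC_sub1 (a : R) : a%:FS - 1 = (a - 1)%:FS.
Proof. by apply: fpsP => m; rewrite fpsDE fpsNE /= mulrnBl. Qed.

Lemma fps_sumE (I : Type) (r : seq I) (P : pred I) (f : I -> {fps R}) n :
  (\sum_(i <- r | P i) f i) n = \sum_(i <- r | P i) f i n.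
Proof. by apply: (big_morph (fun f : {fps R} => f n)) => //=; rewrite mul0rn. Qed.

End PowerSeries.

(** * Functional equation and convergence *)

Section ContinuedFraction.
Variables (R : comUnitRingType) (x q : R).

Lemma coef_Kseries s n : Kseries x q s n =
  if (n < s)%N then (q - 1) * ((catalan n)%:R * q ^+ n)
  else if s == n then (x - 1) * ((catalan n)%:R * q ^+ n) else 0.
Proof.
rewrite /Kseries fpsDE !fpsC_sub1 fps_natr fpsC_exp -!mulrA !coef_fpsCM.
rewrite coef_fpsZn fps_sumE eq_sym.
under eq_bigr do
  rewrite fps_natr exprMn fpsC_exp !coef_fpsCM coef_fpsZn.
have [ns|sn|->] := ltngtP n s.
- rewrite !mulr0 add0r (bigD1 (Ordinal ns)) //= eqxx mulr1 big1 ?addr0 // => i.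
  by rewrite -val_eqE eq_sym => /negPf /= ->; rewrite !mulr0.
- rewrite big1 ?mulr0 ?addr0 // => i _.
  by rewrite gtn_eqF ?mulr0 // (ltn_trans _ sn).
rewrite big1 ?mulr0 ?addr0 ?mulr1 // => i _.
by rewrite gtn_eqF ?mulr0.
Qed.

Definition Fseries s : {fps R} := Fps (Fshift x q s).

Lemma Fseries_rec s :
  Fseries s = 1 + 'z * ((Kseries x q s + Fseries s.+1) * Fseries s).
Proof.
apply: fpsP => -[|n]; rewrite fpsDE fps1E coef_fpsZM.
  by rewrite addr0 /= /Fshift big_seq1.
rewrite add0r -[LHS]/(Fshift x q s n.+1) FshiftS fpsME.
apply: eq_bigr => k _; congr (_ * _).
rewrite fpsDE coef_Kseries -[Fseries _ _]/(Fshift x q s.+1 k) /wt.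
(* In each case the coefficient of [K_s] is [wt s k - 1] times that of [F_(s+1)], which is
   [catalan k * q ^ k] when [k <= s]. *)
have [ks|sk|->] := ltngtP (k : nat) s.
- by rewrite Fshift_exc ?(ltnW ks) //; [ring | exact: leqW (ltnW ks)].
- by rewrite add0r mul1r.
by rewrite Fshift_exc //; ring.
Qed.

Let den s g : {fps R} := 1 - 'z * Kseries x q s - 'z * g.

Lemma den_Fseries s : den s (Fseries s.+1) * Fseries s = 1.
Proof.
transitivity (Fseries s - 'z * ((Kseries x q s + Fseries s.+1) * Fseries s)).
  by rewrite /den; ring.
by rewrite {1}Fseries_rec addrK.
Qed.

(** Replacing the tail [F_(s+1)] by [g] changes the denominator by a multiple of [z], so an error in
    the tail gains a factor [z] one level up. *)
Lemma convergentE s g : exists h,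
  (den s g)^-1 - Fseries s = 'z * ((g - Fseries s.+1) * h).
Proof.
have Ud : den s g \is a GRing.unit by case: (denominator_unit (Kseries x q) s g).
exists ((den s g)^-1 * Fseries s).
apply: (mulrI Ud); rewrite mulrBr mulrV // -{1}(den_Fseries s).
transitivity (den s g * (den s g)^-1 * ('z * (g - Fseries s.+1) * Fseries s));
  last by ring.
by rewrite mulrV // /den; ring.
Qed.

Lemma convergent_Fseries s m : exists h,
  convergent (Kseries x q) s m - Fseries s = 'z ^+ m.+1 * h.
Proof.
elim: m s => [|m IHm] s /=.
  (* The shortest convergent is the fraction with tail 0. *)
  have [h] := convergentE s 0; rewrite /den mulr0 subr0 => ->.
  by eexists; rewrite expr1.
have [h ->] := convergentE s (convergent (Kseries x q) s.+1 m).
have [g ->] := IHm s.+1; exists (g * h).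
by rewrite [in RHS]exprS -!mulrA.
Qed.

Lemma continued_fraction_F312 : continued_fraction_eq (Kseries x q) (F312 x q).
Proof.
(* For [m >= n] the error is divisible by [z ^ m.+1], hence vanishes in degree [n]. *)
move=> n; exists n => m nm; rewrite -Fshift0 -[Fshift _ _ _ _]/(Fseries 0 n).
have [h /eqP] := convergent_Fseries 0 m; rewrite subr_eq => /eqP ->.
by rewrite fpsDE coef_fpsZnM ltnS nm add0r.
Qed.

End ContinuedFraction.

Theorem theorem3p8 :
  let x : {mpoly int[2]} := 'X_0 in
  let q : {mpoly int[2]} := 'X_1 in
  continued_fraction_eq (Kseries x q) (F312 x q).
Proof. by move=> x q; apply: continued_fraction_F312. Qed.
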